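(* Let $k_1,k_2,k_3,\beta_1,\beta_2,\delta$ be real numbers such that $k_1+2k_2+k_3=1$; $k_i\ge 0$ for $i=1,2,3$; $(k_1,k_2)\neq(0,0)$; $(k_2,k_3)\neq(0,0)$; $\beta_1(\beta_1+\beta_2)>0$; $\beta_2(\beta_1+\beta_2)>0$; and $\delta>0$. Let $P$ be the Kadiyala production function, defined for $u>0$, $v>0$ by $$P(u,v)=\left(k_1u^{\beta_1+\beta_2}+2k_2u^{\beta_1}v^{\beta_2}+k_3v^{\beta_1+\beta_2}\right)^{\frac{\delta}{\beta_1+\beta_2}},$$ and let the Kadiyala surface be the graph of $P$, i.e. the surface in $\mathbb{R}^3$ parametrized by $G(u,v)=(u,v,P(u,v))$, $u,v>0$. Then the Kadiyala surface is developable if and only if at least one of the following conditions holds: \begin{itemize} \item $\delta=1$ (i.e. the Kadiyala production function has constant returns to scale); \item $k_2=0$ and $\beta_1+\beta_2=1$; \item $\beta_1=\beta_2=1$ and $k_2^2-k_1k_3=0$. \end{itemize} Moreover, in each of the last two cases, $P$ is a perfect substitutes production function.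
   Context: For a smooth function $f$ on an open set $U\subset\mathbb{R}^2$, its graph is the surface in $\mathbb{R}^3$ parametrized by $F(x_1,x_2)=(x_1,x_2,f(x_1,x_2))$. The first fundamental form has matrix $I=(g_{ij})$ with $g_{ij}=\langle \partial F/\partial x_i,\partial F/\partial x_j\rangle$; the second fundamental form has matrix $II=(h_{ij})$ with $h_{ij}=\langle N,\partial^2F/\partial x_i\partial x_j\rangle$, where $N$ is the unit normal $N=\frac{\partial_{x_1}F\times\partial_{x_2}F}{\|\partial_{x_1}F\times\partial_{x_2}F\|}$. The Gaussian curvature at a point is $K=\det II/\det I$. A surface is called developable if its Gaussian curvature is zero at all its points. A perfect substitutes production function (with returns-to-scale parameter $\delta$) is a function of the form $(u,v)\mapsto(au+bv)^{\delta}$ with constants $a,b>0$. *)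

(* Defs.v *)
From Stdlib Require Import Reals.
From Coquelicot Require Import Coquelicot.
Open Scope R_scope.

Definition vec3 : Type := (R * R * R)%type.
Definition vx (p : vec3) : R := fst (fst p).
Definition vy (p : vec3) : R := snd (fst p).
Definition vz (p : vec3) : R := snd p.

Definition dot3 (p q : vec3) : R := vx p * vx q + vy p * vy q + vz p * vz q.

Definition cross3 (p q : vec3) : vec3 :=
  (vy p * vz q - vz p * vy q,
   vz p * vx q - vx p * vz q,
   vx p * vy q - vy p * vx q).

Definition norm3 (p : vec3) : R := sqrt (dot3 p p).

Definition scale3 (c : R) (p : vec3) : vec3 := (c * vx p, c * vy p, c * vz p).

Inductive coord : Set := X1 | X2.

(* [Derive] is total: these partial derivatives are the usual ones where they
   exist, as they do for a smooth map at a point of its open domain; they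
   depend only on the values of the map near that point. *)
Definition partial (i : coord) (f : R -> R -> R) (x1 x2 : R) : R :=
  match i with
  | X1 => Derive (fun t => f t x2) x1
  | X2 => Derive (fun t => f x1 t) x2
  end.

Definition partial3 (i : coord) (F : R -> R -> vec3) (x1 x2 : R) : vec3 :=
  (partial i (fun s t => vx (F s t)) x1 x2,
   partial i (fun s t => vy (F s t)) x1 x2,
   partial i (fun s t => vz (F s t)) x1 x2).

Definition det2 (M : coord -> coord -> R) : R :=
  M X1 X1 * M X2 X2 - M X1 X2 * M X2 X1.

Definition unit_normal (F : R -> R -> vec3) (x1 x2 : R) : vec3 :=
  let n := cross3 (partial3 X1 F x1 x2) (partial3 X2 F x1 x2) in
  scale3 (/ norm3 n) n.

Definition first_form (F : R -> R -> vec3) (x1 x2 : R) (i j : coord) : R :=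
  dot3 (partial3 i F x1 x2) (partial3 j F x1 x2).

Definition second_form (F : R -> R -> vec3) (x1 x2 : R) (i j : coord) : R :=
  dot3 (unit_normal F x1 x2) (partial3 i (partial3 j F) x1 x2).

Definition gaussian_curvature (F : R -> R -> vec3) (x1 x2 : R) : R :=
  det2 (second_form F x1 x2) / det2 (first_form F x1 x2).

Definition developable (U : R -> R -> Prop) (F : R -> R -> vec3) : Prop :=
  forall x1 x2 : R, U x1 x2 -> gaussian_curvature F x1 x2 = 0.

Definition graph (f : R -> R -> R) (x1 x2 : R) : vec3 := (x1, x2, f x1 x2).

Definition quadrant (u v : R) : Prop := 0 < u /\ 0 < v.

(* Production functions are considered on [quadrant] only, where every base
   passed to [Rpower] below is positive, so that [Rpower] is the real power. *)
Definition kadiyala (k1 k2 k3 beta1 beta2 delta u v : R) : R :=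
  Rpower (k1 * Rpower u (beta1 + beta2)
          + 2 * k2 * Rpower u beta1 * Rpower v beta2
          + k3 * Rpower v (beta1 + beta2))
         (delta / (beta1 + beta2)).

Definition perfect_substitutes (delta : R) (f : R -> R -> R) : Prop :=
  exists a b : R, 0 < a /\ 0 < b /\
    forall u v : R, quadrant u v -> f u v = Rpower (a * u + b * v) delta.

(* Main.v *)
(** Write [s = beta1 + beta2], [P = Q^(delta/s)], and [A], [2B], [C] for the
    three terms of the [s]-homogeneous function [Q]. The curvature of a graph
    vanishes exactly where the Hessian determinant does, and for [P] this
    determinant is a positive multiple of [(delta - 1) E], where
    [E = s^2 (s-1) A C + 2 s B (beta2 (beta2-1) A + beta1 (beta1-1) C)
         - 4 beta1 beta2 B^2].
    On the ray [v = 1], [E] is [u^beta1] times a combination of the powers of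
    [u] with exponents [0], [beta1], [beta2], [s]; evaluating at [u = e^n] for
    [n = 0..3] gives a Vandermonde system that determines the coefficients. *)

Require Import Defs.
From Stdlib Require Import Reals Lra.
From Coquelicot Require Import Coquelicot.
Open Scope R_scope.

(** * Curvature of a graph *)

Lemma partial_ext (i : coord) (f g : R -> R -> R) (x y : R) :
  (forall s t, f s t = g s t) -> partial i f x y = partial i g x y.
Proof. intros H; destruct i; apply Derive_ext; intros; apply H. Qed.

Lemma partial_const (i : coord) (c x y : R) : partial i (fun _ _ => c) x y = 0.
Proof. destruct i; exact (Derive_const c _). Qed.

Definition delta_coord (i j : coord) : R :=
  match i, j with X1, X1 | X2, X2 => 1 | _, _ => 0 end.

Lemma partial3_graph (f : R -> R -> R) (i : coord) (x y : R) :
  partial3 i (graph f) x y = (delta_coord i X1, delta_coord i X2, partial i f x y).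
Proof.
  destruct i; unfold partial3, graph, vx, vy, vz; simpl;
    now rewrite Derive_id, Derive_const.
Qed.

Lemma partial3_partial3_graph (f : R -> R -> R) (i j : coord) (x y : R) :
  partial3 i (partial3 j (graph f)) x y = (0, 0, partial i (partial j f) x y).
Proof.
  apply (f_equal2 pair); [apply (f_equal2 pair)|].
  - rewrite <- (partial_const i (delta_coord j X1) x y).
    apply partial_ext; intros; now rewrite partial3_graph.
  - rewrite <- (partial_const i (delta_coord j X2) x y).
    apply partial_ext; intros; now rewrite partial3_graph.
  - apply partial_ext; intros; now rewrite partial3_graph.
Qed.

(** With gradient [(p, q)] and [n = sqrt (1 + p^2 + q^2)], the unit normal is [(-p, -q, 1) / n], so
    the second form is the Hessian over [n], while the first form has determinant [n^2]. *)
Lemma gaussian_curvature_graph (f : R -> R -> R) (x y : R) :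
  gaussian_curvature (graph f) x y
  = det2 (fun i j => partial i (partial j f) x y)
    / (1 + partial X1 f x y ^ 2 + partial X2 f x y ^ 2) ^ 2.
Proof.
  unfold gaussian_curvature, second_form, first_form, unit_normal, det2.
  rewrite !partial3_partial3_graph, !partial3_graph; unfold norm3.
  set (p := partial X1 f x y); set (q := partial X2 f x y).
  unfold cross3, dot3, scale3, vx, vy, vz, delta_coord; simpl.
  match goal with |- context [sqrt ?e] => replace e with (1 + p ^ 2 + q ^ 2) by ring end.
  assert (H : 0 < 1 + p ^ 2 + q ^ 2) by nra.
  pose proof (sqrt_lt_R0 _ H) as Hn.
  pose proof (sqrt_sqrt _ (Rlt_le _ _ H)) as Hnn.
  set (n := sqrt (1 + p ^ 2 + q ^ 2)) in *.
  (* This is [1 + p^2 + q^2] in the shape that [simpl] leaves on the right-hand side. *)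
  set (m := 1 + p * (p * 1) + q * (q * 1)).
  assert (Hm : m = n * n) by (unfold m; rewrite Hnn; ring).
  match goal with |- _ / ?e = _ => replace e with m by (unfold m; ring) end.
  rewrite Hm. field. lra.
Qed.

Lemma gaussian_curvature_graph_eq0 (f : R -> R -> R) (x y : R) :
  gaussian_curvature (graph f) x y = 0
  <-> det2 (fun i j => partial i (partial j f) x y) = 0.
Proof.
  rewrite gaussian_curvature_graph.
  assert (H : 0 < 1 + partial X1 f x y ^ 2 + partial X2 f x y ^ 2) by nra.
  split; intros E.
  - apply Rmult_integral in E; destruct E as [E|E]; [exact E|exfalso].
    revert E; apply Rinv_neq_0_compat, pow_nonzero; lra.
  - rewrite E; apply Rmult_0_l.
Qed.

(** * The base [Q] and the Hessian determinant of [P] *)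

Definition kadiyala_base (k1 k2 k3 a b u v : R) : R :=
  k1 * Rpower u (a + b) + 2 * k2 * Rpower u a * Rpower v b
  + k3 * Rpower v (a + b).

(* The Euler derivatives [u d/du] and [v d/dv] of [kadiyala_base]. *)
Definition base_u (k1 k2 k3 a b u v : R) : R :=
  (a + b) * k1 * Rpower u (a + b) + 2 * a * k2 * Rpower u a * Rpower v b.
Definition base_v (k1 k2 k3 a b u v : R) : R :=
  (a + b) * k3 * Rpower v (a + b) + 2 * b * k2 * Rpower u a * Rpower v b.

(** [Rpower] is an exponential, hence positive at all real arguments, and some coefficient is
    positive because of the weighted sum. *)
Lemma kadiyala_base_pos (k1 k2 k3 a b u v : R) :
  k1 + 2 * k2 + k3 = 1 -> 0 <= k1 -> 0 <= k2 -> 0 <= k3 ->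
  0 < kadiyala_base k1 k2 k3 a b u v.
Proof.
  intros Hs H1 H2 H3; unfold kadiyala_base.
  assert (HA : 0 < Rpower u (a + b)) by apply exp_pos.
  assert (HC : 0 < Rpower v (a + b)) by apply exp_pos.
  assert (HB : 0 < Rpower u a * Rpower v b) by (apply Rmult_lt_0_compat; apply exp_pos).
  rewrite (Rmult_assoc (2 * k2)).
  set (A := Rpower u (a + b)) in *; set (C := Rpower v (a + b)) in *.
  set (B := Rpower u a * Rpower v b) in *.
  pose proof (Rmult_le_pos _ _ H1 (Rlt_le _ _ HA)).
  pose proof (Rmult_le_pos _ _ H2 (Rlt_le _ _ HB)).
  pose proof (Rmult_le_pos _ _ H3 (Rlt_le _ _ HC)).
  destruct (Req_dec k1 0) as [->|]; [destruct (Req_dec k2 0) as [->|]|]; nra.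
Qed.

Lemma locally_pos (x : R) : 0 < x -> locally x (fun t => 0 < t).
Proof. intros H; now apply (open_gt 0 x). Qed.

Section Derivatives.
Variables (k1 k2 k3 a b d : R).
Hypothesis base_pos : forall u v, 0 < kadiyala_base k1 k2 k3 a b u v.

Let P := kadiyala k1 k2 k3 a b d.
Let Q := kadiyala_base k1 k2 k3 a b.
Let Qu := base_u k1 k2 k3 a b.
Let Qv := base_v k1 k2 k3 a b.
Let p := d / (a + b).

Lemma partial_kadiyala_u (u v : R) : 0 < u ->
  partial X1 P u v = p * P u v * Qu u v / (Q u v * u).
Proof.
  intros Hu; apply is_derive_unique; pose proof (base_pos u v) as HQ.
  unfold P, Qu, Q, kadiyala, base_u, kadiyala_base, Rpower in *; fold p.
  auto_derive; [repeat split; auto|field; lra].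
Qed.

Lemma partial_kadiyala_v (u v : R) : 0 < v ->
  partial X2 P u v = p * P u v * Qv u v / (Q u v * v).
Proof.
  intros Hv; apply is_derive_unique; pose proof (base_pos u v) as HQ.
  unfold P, Qv, Q, kadiyala, base_v, kadiyala_base, Rpower in *; fold p.
  auto_derive; [repeat split; auto|field; lra].
Qed.

(** Reflects [u^2 d^2/du^2 = (u d/du)^2 - u d/du]; the last bracket is [(u d/du)^2 Q]. *)
Lemma partial_kadiyala_uu (u v : R) : 0 < u ->
  partial X1 (partial X1 P) u v
  = p * P u v / (Q u v * u ^ 2)
    * ((p - 1) * Qu u v ^ 2 / Q u v - Qu u v
       + ((a + b) ^ 2 * k1 * Rpower u (a + b)
          + 2 * a ^ 2 * k2 * Rpower u a * Rpower v b)).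
Proof.
  intros Hu; pose proof (base_pos u v) as HQ.
  transitivity (Derive (fun t => p * P t v * Qu t v / (Q t v * t)) u).
  (* The first-derivative formula is available for [t > 0], that is, near [u]. *)
  - apply Derive_ext_loc; generalize (locally_pos u Hu); apply filter_imp.
    intros t Ht; now apply partial_kadiyala_u.
  - apply is_derive_unique.
    unfold P, Qu, Q, kadiyala, base_u, kadiyala_base, Rpower in *; fold p.
    auto_derive; [repeat split; auto; nra|field; lra].
Qed.

Lemma partial_kadiyala_vv (u v : R) : 0 < v ->
  partial X2 (partial X2 P) u v
  = p * P u v / (Q u v * v ^ 2)
    * ((p - 1) * Qv u v ^ 2 / Q u v - Qv u v
       + ((a + b) ^ 2 * k3 * Rpower v (a + b)
          + 2 * b ^ 2 * k2 * Rpower u a * Rpower v b)).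
Proof.
  intros Hv; pose proof (base_pos u v) as HQ.
  transitivity (Derive (fun t => p * P u t * Qv u t / (Q u t * t)) v).
  - apply Derive_ext_loc; generalize (locally_pos v Hv); apply filter_imp.
    intros t Ht; now apply partial_kadiyala_v.
  - apply is_derive_unique.
    unfold P, Qv, Q, kadiyala, base_v, kadiyala_base, Rpower in *; fold p.
    auto_derive; [repeat split; auto; nra|field; lra].
Qed.

Lemma partial_kadiyala_uv (u v : R) : 0 < u -> 0 < v ->
  partial X1 (partial X2 P) u v
  = p * P u v / (Q u v * u * v)
    * ((p - 1) * Qu u v * Qv u v / Q u v
       + 2 * a * b * k2 * Rpower u a * Rpower v b).
Proof.
  intros Hu Hv; pose proof (base_pos u v) as HQ.
  transitivity (Derive (fun t => p * P t v * Qv t v / (Q t v * v)) u).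
  (* Here [v] is fixed, so the formula holds for every real [t]. *)
  - apply Derive_ext; intros t; now apply partial_kadiyala_v.
  - apply is_derive_unique.
    unfold P, Qu, Qv, Q, kadiyala, base_u, base_v, kadiyala_base, Rpower in *; fold p.
    auto_derive; [repeat split; auto; nra|field; lra].
Qed.

Lemma partial_kadiyala_vu (u v : R) : 0 < u -> 0 < v ->
  partial X2 (partial X1 P) u v
  = p * P u v / (Q u v * u * v)
    * ((p - 1) * Qu u v * Qv u v / Q u v
       + 2 * a * b * k2 * Rpower u a * Rpower v b).
Proof.
  intros Hu Hv; pose proof (base_pos u v) as HQ.
  transitivity (Derive (fun t => p * P u t * Qu u t / (Q u t * u)) v).
  - apply Derive_ext; intros t; now apply partial_kadiyala_u.
  - apply is_derive_unique.
    unfold P, Qu, Qv, Q, kadiyala, base_u, base_v, kadiyala_base, Rpower in *; fold p.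
    auto_derive; [repeat split; auto; nra|field; lra].
Qed.

(** The [E] of the overview. With [s = a + b] it equals [(s - 1) Qu Qv - s Q Quv], where
    [Quv = 2 a b B] is the mixed Euler derivative of [Q]. *)
Definition hessian_factor (A B C : R) : R :=
  (a + b) ^ 2 * (a + b - 1) * A * C
  + 2 * (a + b) * B * (b * (b - 1) * A + a * (a - 1) * C)
  - 4 * a * b * B ^ 2.

(** Homogeneity gives [Qu + Qv = s Q], [Quu + Quv = s Qu] and [Quv + Qvv = s Qv] for the Euler
    derivatives. Eliminating [Quu] and [Qvv] leaves [E] times [(s - 1) + s (p - 1) = d - 1]. *)
Lemma kadiyala_hessian (u v : R) : a + b <> 0 -> 0 < u -> 0 < v ->
  det2 (fun i j => partial i (partial j P) u v)
  = (p * P u v / (Q u v * u * v)) ^ 2 * (d - 1)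
    * hessian_factor (k1 * Rpower u (a + b)) (k2 * Rpower u a * Rpower v b)
                     (k3 * Rpower v (a + b)).
Proof.
  intros Hs Hu Hv; pose proof (base_pos u v) as HQ; unfold det2.
  rewrite partial_kadiyala_uu, partial_kadiyala_vv, partial_kadiyala_uv,
    partial_kadiyala_vu by assumption.
  generalize (P u v); intros w.
  unfold hessian_factor, p, Qu, Qv, Q, base_u, base_v, kadiyala_base in *.
  field; lra.
Qed.

(** The factor [d - 1] is the same at all points, and the squared prefactor never vanishes on the
    quadrant. *)
Lemma developable_kadiyala : a + b <> 0 -> d <> 0 ->
  developable quadrant (graph P)
  <-> d = 1 \/ forall u v, quadrant u v ->
    hessian_factor (k1 * Rpower u (a + b)) (k2 * Rpower u a * Rpower v b)
                   (k3 * Rpower v (a + b)) = 0.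
Proof.
  intros Hs Hd; split.
  - intros H; destruct (Req_dec d 1) as [|Hd1]; [now left|right].
    intros u v Huv; specialize (H u v Huv); destruct Huv as [Hu Hv].
    apply (proj1 (gaussian_curvature_graph_eq0 _ _ _)) in H.
    rewrite kadiyala_hessian in H by assumption.
    apply Rmult_integral in H; destruct H as [H|H]; [exfalso|exact H].
    apply Rmult_integral in H; destruct H as [H|H]; [|lra].
    revert H; apply pow_nonzero.
    pose proof (base_pos u v) as HQ; fold (Q u v) in HQ.
    assert (HP : 0 < P u v) by apply exp_pos.
    unfold p, Rdiv; repeat apply Rmult_integral_contrapositive_currified;
      try apply Rinv_neq_0_compat; try lra.
    repeat apply Rmult_integral_contrapositive_currified; lra.
  - intros H u v Huv; apply gaussian_curvature_graph_eq0.
    rewrite kadiyala_hessian by (assumption || apply Huv).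
    destruct H as [->|H]; [ring|rewrite (H u v Huv); ring].
Qed.
End Derivatives.

(** * Vanishing of the Hessian factor on the quadrant *)

Lemma vandermonde4 (x y z w cx cy cz cw : R) :
  (forall n : nat, cx * x ^ n + cy * y ^ n + cz * z ^ n + cw * w ^ n = 0) ->
  x <> y -> x <> z -> x <> w -> cx = 0.
Proof.
  intros H Hy Hz Hw.
  assert (E : cx * ((x - y) * (x - z) * (x - w)) = 0).
  { set (S n := cx * x ^ n + cy * y ^ n + cz * z ^ n + cw * w ^ n).
    (* The coefficients are those of [(X - y) (X - z) (X - w)], which vanishes at [y], [z], [w]. *)
    transitivity (S 3%nat - (y + z + w) * S 2%nat
                  + (y * z + y * w + z * w) * S 1%nat - y * z * w * S 0%nat).
    - unfold S; ring.
    - unfold S; rewrite !H; ring. }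
  apply Rmult_integral in E; destruct E as [E|E]; [exact E|exfalso].
  revert E; repeat apply Rmult_integral_contrapositive_currified; lra.
Qed.

Lemma exp_neq (x y : R) : x <> y -> exp x <> exp y.
Proof. intros H E; now apply H, exp_inv. Qed.

Lemma Rpower_exp_INR (n : nat) (c : R) : Rpower (exp (INR n)) c = exp c ^ n.
Proof.
  unfold Rpower; rewrite ln_exp, Rmult_comm, <- Rpower_pow by apply exp_pos.
  unfold Rpower; rewrite ln_exp; f_equal; ring.
Qed.

(** Take [u = exp n], [v = 1] and divide by [u^a]: the terms in [B^2], [B C], [A C], [A B] become,
    in this order, the four powers below. *)
Lemma hessian_factor_relation (k1 k2 k3 a b : R) :
  (forall u v, quadrant u v ->
    hessian_factor a b (k1 * Rpower u (a + b)) (k2 * Rpower u a * Rpower v b)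
                   (k3 * Rpower v (a + b)) = 0) ->
  forall n : nat,
    - (4 * a * b * k2 ^ 2) * exp a ^ n
    + 2 * (a + b) * k2 * k3 * a * (a - 1) * 1 ^ n
    + (a + b) ^ 2 * (a + b - 1) * k1 * k3 * exp b ^ n
    + 2 * (a + b) * k1 * k2 * b * (b - 1) * exp (a + b) ^ n = 0.
Proof.
  intros H n.
  specialize (H (exp (INR n)) 1 (conj (exp_pos _) Rlt_0_1)).
  unfold hessian_factor in H.
  assert (H1 : forall c, Rpower 1 c = 1)
    by (intros c; unfold Rpower; rewrite ln_1, Rmult_0_r; apply exp_0).
  rewrite !H1, !Rpower_exp_INR in H.
  rewrite exp_plus, !Rpow_mult_distr in *; rewrite pow1.
  assert (HX : 0 < exp a ^ n) by (apply pow_lt, exp_pos).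
  apply (Rmult_eq_reg_l (exp a ^ n)); [|lra].
  rewrite Rmult_0_r, <- H; ring.
Qed.

Lemma hessian_factor_eq0 (k1 k2 k3 a b : R) :
  (k1, k2) <> (0, 0) -> (k2, k3) <> (0, 0) ->
  a * (a + b) > 0 -> b * (a + b) > 0 ->
  (forall u v, quadrant u v ->
    hessian_factor a b (k1 * Rpower u (a + b)) (k2 * Rpower u a * Rpower v b)
                   (k3 * Rpower v (a + b)) = 0)
  <-> (k2 = 0 /\ a + b = 1) \/ (a = 1 /\ b = 1 /\ k2 ^ 2 - k1 * k3 = 0).
Proof.
  intros H12 H23 Ha Hb.
  assert (Ha0 : a <> 0) by nra.
  assert (Hb0 : b <> 0) by nra.
  assert (Hs0 : a + b <> 0) by nra.
  split.
  - intros H; pose proof (hessian_factor_relation _ _ _ _ _ H) as R; clear H.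
    destruct (Req_dec k2 0) as [K2|K2].
    + left; split; [exact K2|]; subst k2.
      assert (K1 : k1 <> 0) by (intros ->; now apply H12).
      assert (K3 : k3 <> 0) by (intros ->; now apply H23).
      (* For [k2 = 0] only the [A C] term survives. *)
      specialize (R 0%nat); simpl in R.
      assert (E : (a + b) * (a + b) * k1 * k3 * (a + b - 1) = 0) by lra.
      apply Rmult_integral in E; destruct E as [E|E]; [exfalso|lra].
      revert E; repeat apply Rmult_integral_contrapositive_currified; assumption.
    + right.
      assert (Ea : exp a <> 1) by (rewrite <- exp_0; now apply exp_neq).
      assert (Eas : exp a <> exp (a + b)) by (apply exp_neq; lra).
      assert (Es : exp (a + b) <> 1) by (rewrite <- exp_0; now apply exp_neq).
      destruct (Req_dec a b) as [Eab|Nab].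
      * subst b.
        (* The nodes [exp a] and [exp b] merge; a node [0] with coefficient [0] restores four
           terms. *)
        assert (R' : forall n, 2 * (a + a) * k2 * k3 * a * (a - 1) * 1 ^ n
          + ((a + a) ^ 2 * (a + a - 1) * k1 * k3 - 4 * a * a * k2 ^ 2) * exp a ^ n
          + 2 * (a + a) * k1 * k2 * a * (a - 1) * exp (a + a) ^ n
          + 0 * 0 ^ n = 0).
        { intros n; eapply eq_trans; [|exact (R n)]; ring. }
        assert (E1 : 2 * (a + a) * k2 * k3 * a * (a - 1) = 0)
          by (eapply vandermonde4; [exact R'|..]; lra).
        assert (E2 : (a + a) ^ 2 * (a + a - 1) * k1 * k3 - 4 * a * a * k2 ^ 2 = 0).
        { eapply (vandermonde4 (exp a) 1 (exp (a + a)) 0 _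
            (2 * (a + a) * k2 * k3 * a * (a - 1))
            (2 * (a + a) * k1 * k2 * a * (a - 1)) 0);
            [intros n; eapply eq_trans; [|exact (R' n)]; ring|..]; try lra.
          pose proof (exp_pos a); lra. }
        (* As [k2] is nonzero, this forces [k3] to be nonzero; then [E1] gives [a = 1], and this
           equation becomes [k1 * k3 = k2 ^ 2]. *)
        assert (E3 : (2 * a - 1) * (k1 * k3) = k2 ^ 2).
        { apply (Rmult_eq_reg_l (4 * a * a)); [lra|nra]. }
        assert (K3 : k3 <> 0).
        { intros ->; apply K2; nra. }
        assert (A1 : a = 1).
        { apply Rmult_integral in E1; destruct E1 as [E1|E1]; [exfalso|lra].
          revert E1; repeat apply Rmult_integral_contrapositive_currified; lra. }
        subst a; repeat split; lra.
      * exfalso.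
        (* For distinct [a] and [b], the node [exp a] differs from the other three, yet its
           coefficient is nonzero. *)
        assert (E : - (4 * a * b * k2 ^ 2) = 0).
        { eapply vandermonde4; [exact R|assumption|now apply exp_neq|assumption]. }
        assert (N : 4 * a * b * k2 ^ 2 <> 0).
        { repeat apply Rmult_integral_contrapositive_currified; lra. }
        lra.
  - intros H u v [Hu Hv]; unfold hessian_factor; destruct H as [[-> Hs]|(-> & -> & Hk)].
    + rewrite Hs; ring.
    + rewrite !Rpower_plus, !Rpower_1 by assumption.
      (* For [a = b = 1], [E = 4 (A C - B^2)]. *)
      transitivity (4 * (u * v) ^ 2 * - (k2 ^ 2 - k1 * k3)); [ring|rewrite Hk; ring].
Qed.

(** * The cases of perfect substitutes *)

Lemma kadiyala_perfect_substitutes_linear (k1 k3 a b d : R) :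
  0 < k1 -> 0 < k3 -> a + b = 1 ->
  perfect_substitutes d (kadiyala k1 0 k3 a b d).
Proof.
  intros H1 H3 Hs; exists k1, k3; repeat split; try assumption.
  intros u v [Hu Hv]; unfold kadiyala.
  rewrite Hs, !Rpower_1 by assumption; f_equal; field.
Qed.

(** Since [k2 = sqrt k1 * sqrt k3], the base is the square of [sqrt k1 * u + sqrt k3 * v], and the
    exponent [d / 2] undoes the square. *)
Lemma kadiyala_perfect_substitutes_square (k1 k2 k3 d : R) :
  0 < k1 -> 0 <= k2 -> 0 < k3 -> k2 ^ 2 = k1 * k3 ->
  perfect_substitutes d (kadiyala k1 k2 k3 1 1 d).
Proof.
  intros H1 H2 H3 Hk; exists (sqrt k1), (sqrt k3).
  pose proof (sqrt_lt_R0 _ H1) as S1; pose proof (sqrt_lt_R0 _ H3) as S3.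
  repeat split; try assumption; intros u v [Hu Hv]; unfold kadiyala.
  assert (E2 : k2 = sqrt k1 * sqrt k3).
  { rewrite <- sqrt_mult, <- Hk by lra; symmetry; now apply sqrt_pow2. }
  assert (HL : 0 < sqrt k1 * u + sqrt k3 * v) by nra.
  rewrite !Rpower_plus, !Rpower_1, E2 by assumption.
  (* The selected occurrences are the bare coefficients, not those under a root. *)
  rewrite <- (sqrt_sqrt k1) at 1 by lra; rewrite <- (sqrt_sqrt k3) at 2 by lra.
  match goal with |- Rpower ?e _ = _ =>
    replace e with (Rpower (sqrt k1 * u + sqrt k3 * v) (1 + 1))
      by (rewrite Rpower_plus, Rpower_1 by assumption; ring) end.
  rewrite Rpower_mult; f_equal; field.
Qed.

Theorem theorem4p3
  (k1 k2 k3 beta1 beta2 delta : R)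
  (hk_sum : k1 + 2 * k2 + k3 = 1)
  (hk1 : 0 <= k1) (hk2 : 0 <= k2) (hk3 : 0 <= k3)
  (hk12 : (k1, k2) <> (0, 0)) (hk23 : (k2, k3) <> (0, 0))
  (hbeta1 : beta1 * (beta1 + beta2) > 0)
  (hbeta2 : beta2 * (beta1 + beta2) > 0)
  (hdelta : delta > 0) :
  (developable quadrant (graph (kadiyala k1 k2 k3 beta1 beta2 delta)) <->
     delta = 1
     \/ (k2 = 0 /\ beta1 + beta2 = 1)
     \/ (beta1 = 1 /\ beta2 = 1 /\ k2 ^ 2 - k1 * k3 = 0))
  /\
  ((k2 = 0 /\ beta1 + beta2 = 1)
   \/ (beta1 = 1 /\ beta2 = 1 /\ k2 ^ 2 - k1 * k3 = 0) ->
     perfect_substitutes delta (kadiyala k1 k2 k3 beta1 beta2 delta)).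
Proof.
  assert (Hs0 : beta1 + beta2 <> 0) by nra.
  split.
  - unfold developable at 1.
    rewrite <- (hessian_factor_eq0 k1 k2 k3 beta1 beta2) by assumption.
    apply developable_kadiyala; [|assumption|lra].
    intros u v; now apply kadiyala_base_pos.
  - intros [[-> Hs]|(-> & -> & Hk)].
    + apply kadiyala_perfect_substitutes_linear; [| |exact Hs].
      * destruct hk1 as [|<-]; [assumption|now destruct hk12].
      * destruct hk3 as [|<-]; [assumption|now destruct hk23].
    (* If [k1] or [k3] were zero, [k2 ^ 2 = k1 * k3] would make [k2] zero too, against [hk12] or
       [hk23]. *)
    + assert (H13 : k1 <> 0 /\ k3 <> 0).
      { split; intros E; subst; assert (k2 = 0) by nra; subst;
          [now apply hk12|now apply hk23]. }
      apply kadiyala_perfect_substitutes_square; lra.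
Qed.
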